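(* For any tetrahedron $T$ in $\mathbb{R}^3$, $$1\leq\frac{\mathrm{Rad}(T)}{\mathrm{rad}(T)}<2.$$ The first inequality is sharp, and equality in it is achieved by normal $\varepsilon$-thick tetrahedra for small $\varepsilon$ (that is, there is $\varepsilon_0>0$ such that $\mathrm{Rad}(T)=\mathrm{rad}(T)$ for every normal $\varepsilon$-thick tetrahedron $T$ with $0<\varepsilon<\varepsilon_0$).
   Context: A tetrahedron is identified with its surface, a convex polyhedral surface in $\mathbb{R}^3$. For a convex surface $S\subset\mathbb{R}^3$, the intrinsic metric $\rho(x,y)$ is the length of a shortest path on $S$ joining $x,y\in S$; $\mathrm{Rad}(S)=\min_{x\in S}\max_{y\in S}\rho(x,y)$ is the intrinsic radius, $\mathrm{rad}(S)=\min_{x\in S}\max_{y\in S}\|x-y\|$ the extrinsic radius, and $\mathrm{diam}(S)=\max_{x,y\in S}\|x-y\|$ the extrinsic diameter. For $\varepsilon>0$, an $\varepsilon$-thick tetrahedron is a tetrahedron $T$ with one edge included in a ball of radius $\varepsilon\,\mathrm{diam}(T)$ centered at the midpoint of its longest edge. An $\varepsilon$-thick tetrahedron is normal if its longest edge and the edge opposite to it are, on the one hand, normal to each other and, on the other hand, both normal to the line through their midpoints. *)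

(* Defs.v *)
From mathcomp Require Export all_boot all_order all_algebra.
From mathcomp Require Export all_classical all_reals all_analysis.

Set Implicit Arguments.
Unset Strict Implicit.
Unset Printing Implicit Defensive.

Export Order.TTheory GRing.Theory Num.Theory numFieldNormedType.Exports.

Local Open Scope classical_set_scope.
Local Open Scope ring_scope.

(* The library norm on 'rV[R]_3 is the max norm; it induces the same topology
   as the Euclidean norm, hence the same continuous paths, but the wrong
   lengths. *)
Definition dot (R : realType) (u v : 'rV[R]_3) : R :=
  \sum_(i < 3) u 0 i * v 0 i.

Definition enorm (R : realType) (u : 'rV[R]_3) : R := Num.sqrt (dot u u).

Definition segment (R : realType) (a b : 'rV[R]_3) : set 'rV[R]_3 :=
  [set (1 - t) *: a + t *: b | t in `[0, 1]].

Definition midpoint (R : realType) (a b : 'rV[R]_3) : 'rV[R]_3 :=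
  2^-1 *: (a + b).

Definition eball (R : realType) (c : 'rV[R]_3) (r : R) : set 'rV[R]_3 :=
  [set x | enorm (x - c) <= r].

(* Same conventions as [variation] and [total_variation], which only apply to
   real-valued functions. *)
Definition polygonal_length (R : realType) (a b : R) (g : R -> 'rV[R]_3)
    (s : seq R) : R :=
  let G := g \o nth b (a :: s) in
  \sum_(0 <= n < size s) enorm (G n.+1 - G n).

Definition curve_length (R : realType) (a b : R) (g : R -> 'rV[R]_3) : \bar R :=
  ereal_sup [set (polygonal_length a b g s)%:E | s in itv_partition a b].

Definition path_in (R : realType) (S : set 'rV[R]_3) (x y : 'rV[R]_3)
    (g : R -> 'rV[R]_3) : Prop :=
  [/\ {within `[0, 1], continuous g}, g 0 = x, g 1 = y
    & forall t, `[0, 1]%classic t -> S (g t)].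

Definition intrinsic_dist (R : realType) (S : set 'rV[R]_3)
    (x y : 'rV[R]_3) : \bar R :=
  ereal_inf [set curve_length 0 1 g | g in path_in S x y].

(* min over x in S of max over y in S of d x y; both extrema are attained for
   the compact surfaces and the two distances considered below. *)
Definition radius (R : realType) (S : set 'rV[R]_3)
    (d : 'rV[R]_3 -> 'rV[R]_3 -> \bar R) : R :=
  fine (ereal_inf [set ereal_sup [set d x y | y in S] | x in S]).

Definition intrinsic_radius (R : realType) (S : set 'rV[R]_3) : R :=
  radius S (intrinsic_dist S).

Definition extrinsic_radius (R : realType) (S : set 'rV[R]_3) : R :=
  radius S (fun x y => (enorm (x - y))%:E).

Definition extrinsic_diam (R : realType) (S : set 'rV[R]_3) : R :=
  sup [set enorm (x - y) | x in S & y in S].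

(* [vert_free] says that the four vertices are affinely independent. *)
Record tetrahedron (R : realType) := Tetrahedron {
  vert :> 'I_4 -> 'rV[R]_3;
  vert_free : row_free (\matrix_(i < 3) (vert (lift ord0 i) - vert ord0))
}.

(* The triangle opposite to vertex i, in barycentric coordinates. *)
Definition face (R : realType) (T : tetrahedron R) (i : 'I_4) :
    set 'rV[R]_3 :=
  [set x | exists w : 'I_4 -> R,
    [/\ forall j, 0 <= w j, w i = 0, \sum_j w j = 1 & x = \sum_j w j *: T j]].

Definition surface (R : realType) (T : tetrahedron R) : set 'rV[R]_3 :=
  \bigcup_i face T i.

Definition longest_edge (R : realType) (T : tetrahedron R) (i j : 'I_4) :
    Prop :=
  i != j /\ forall k l, k != l -> enorm (T k - T l) <= enorm (T i - T j).

Definition thick_along (R : realType) (eps : R) (T : tetrahedron R)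
    (i j : 'I_4) : Prop :=
  longest_edge T i j /\
  exists k l, k != l /\
    segment (T k) (T l) `<=`
      eball (midpoint (T i) (T j)) (eps * extrinsic_diam (surface T)).

(* An eps-thick tetrahedron is one that is [thick_along eps T i j] for some
   i and j; (k, l) is the edge opposite to the longest edge (i, j). For
   eps < 1/2 the longest edge is unique. *)
Definition normal_thick (R : realType) (eps : R) (T : tetrahedron R) : Prop :=
  exists i j k l : 'I_4,
    [/\ thick_along eps T i j, uniq [:: i; j; k; l],
        dot (T i - T j) (T k - T l) = 0,
        dot (T i - T j) (midpoint (T i) (T j) - midpoint (T k) (T l)) = 0
      & dot (T k - T l) (midpoint (T i) (T j) - midpoint (T k) (T l)) = 0].

(* Main.v *)
From mathcomp Require Import ring lra zify.
Require Import Defs.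

Local Open Scope classical_set_scope.
Local Open Scope ring_scope.

Set Implicit Arguments.
Unset Strict Implicit.
Unset Printing Implicit Defensive.

(** Let x realize the extrinsic radius r of T and lie in the face ABC, and write
    x = aA + bB + cC in barycentric coordinates. The point p where the line Ax
    leaves the face through BC satisfies |xp| = a/(1-a) |xA|, so a path through
    p reaches the fourth vertex D with length |xp| + |pD| < (2a/(1-a) + 1) r,
    which is less than 2r when a <= 1/3. Paths crossing one edge of ABC, or two
    edges meeting in B or C, have lengths dominated by affine functions of the
    barycentric coordinates of their end point on BCD, so it suffices to bound
    these functions, or the average of two of them, at B, C and D.

    The extrinsic radius is at least half of any edge by the triangle
    inequality. If the edge opposite to AB is short and close to the midpoint M
    of AB, then rho(M, y) <= |AB|/2 for all y by the same convexity argument. *)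

(** * The Euclidean norm and the equality case of the triangle inequality *)

Section Euclidean.
Variable R : realType.
Implicit Types (u v w : 'rV[R]_3) (a : R).

Lemma dotC u v : dot u v = dot v u.
Proof. by apply: eq_bigr => i _; rewrite mulrC. Qed.

Lemma dotDl u v w : dot (u + v) w = dot u w + dot v w.
Proof. by rewrite -big_split; apply: eq_bigr => i _; rewrite mxE mulrDl. Qed.

Lemma dotZl a u v : dot (a *: u) v = a * dot u v.
Proof. by rewrite /dot mulr_sumr; apply: eq_bigr => i _; rewrite mxE mulrA. Qed.

Lemma dotDr u v w : dot u (v + w) = dot u v + dot u w.
Proof. by rewrite dotC dotDl !(dotC u). Qed.

Lemma dotZr a u v : dot u (a *: v) = a * dot u v.
Proof. by rewrite dotC dotZl dotC. Qed.

Lemma dot_ge0 u : 0 <= dot u u.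
Proof. by apply: sumr_ge0 => i _; rewrite -expr2 sqr_ge0. Qed.

Lemma dot_eq0 u : dot u u = 0 -> u = 0.
Proof.
move=> /eqP; rewrite psumr_eq0 => [/allP u0|i _]; last by rewrite -expr2 sqr_ge0.
apply/rowP => i; rewrite mxE.
by have := u0 i (mem_index_enum i); rewrite /= mulf_eq0 orbb => /eqP.
Qed.

Lemma enorm_ge0 u : 0 <= enorm u.
Proof. exact: sqrtr_ge0. Qed.

Lemma enorm_sqr u : enorm u ^+ 2 = dot u u.
Proof. by rewrite sqr_sqrtr ?dot_ge0. Qed.

Lemma enorm0 : enorm (0 : 'rV[R]_3) = 0.
Proof. by rewrite /enorm -(scale0r 0) dotZl mul0r sqrtr0. Qed.

Lemma enorm_eq0 u : enorm u = 0 -> u = 0.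
Proof. by move=> u0; apply: dot_eq0; rewrite -enorm_sqr u0 expr0n. Qed.

Lemma enormZ a u : enorm (a *: u) = `|a| * enorm u.
Proof.
by rewrite /enorm dotZl dotZr mulrA -expr2 sqrtrM ?sqr_ge0// sqrtr_sqr.
Qed.

Lemma enormN u : enorm (- u) = enorm u.
Proof. by rewrite -scaleN1r enormZ normrN normr1 mul1r. Qed.

Lemma enormB u v : enorm (u - v) = enorm (v - u).
Proof. by rewrite -enormN opprB. Qed.

(** The vector [enorm v *: u - enorm u *: v] has squared norm [2 |u| |v| (|u| |v| - dot u v)]. When
    both norms are nonzero, this gives the inequality and its equality case at once. *)
Lemma dot_le_enorm u v : dot u v <= enorm u * enorm v ?= iff
  (enorm v *: u == enorm u *: v).
Proof.
have E : dot (enorm v *: u - enorm u *: v) (enorm v *: u - enorm u *: v) =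
    2 * (enorm u * enorm v) * (enorm u * enorm v - dot u v).
  rewrite -scaleNr !(dotDl, dotDr, dotZl, dotZr) -!enorm_sqr (dotC v u).
  by ring.
have [u0|uN0] := eqVneq (enorm u) 0.
  rewrite u0 (enorm_eq0 u0) scaler0 scale0r eqxx mul0r -(scale0r 0) dotZl mul0r.
  exact/leif_refl.
have [v0|vN0] := eqVneq (enorm v) 0.
  rewrite v0 (enorm_eq0 v0) scaler0 scale0r eqxx mulr0 -(scale0r 0) dotZr mul0r.
  exact/leif_refl.
have uv0 : 0 < 2 * (enorm u * enorm v).
  by rewrite !mulr_gt0// lt_neqAle enorm_ge0 eq_sym ?uN0 ?vN0.
split.
  by rewrite -subr_ge0 -(pmulr_rge0 _ uv0) -E dot_ge0.
apply/eqP/eqP => [uv|]; last first.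
  move/eqP; rewrite -subr_eq0 => /eqP uv; move: E; rewrite uv.
  rewrite -{1}(scale0r 0) dotZl mul0r => /esym/eqP.
  by rewrite mulf_eq0 gt_eqF//= subr_eq0 => /eqP.
by apply/eqP; rewrite -subr_eq0; apply/eqP/dot_eq0; rewrite E uv subrr mulr0.
Qed.

(** The squares of the two sides differ by twice the Cauchy-Schwarz gap, so the equality case
    carries over. *)
Lemma enormD u v : enorm (u + v) <= enorm u + enorm v ?= iff
  (enorm v *: u == enorm u *: v).
Proof.
have [le_uv eq_uv] := dot_le_enorm u v.
have E : enorm (u + v) ^+ 2 =
    (enorm u + enorm v) ^+ 2 - 2 * (enorm u * enorm v - dot u v).
  rewrite enorm_sqr !(dotDl, dotDr) (dotC v u) sqrrD !enorm_sqr.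
  by ring.
have n0 : 0 <= enorm u + enorm v by rewrite addr_ge0 ?enorm_ge0.
split.
  by rewrite -ler_sqr ?nnegrE ?enorm_ge0// E gerBl mulr_ge0// subr_ge0.
rewrite -(@eqrXn2 _ 2)// ?enorm_ge0//.
rewrite E -subr_eq0 addrAC subrr add0r oppr_eq0 mulf_eq0 pnatr_eq0/= subr_eq0.
by rewrite -eq_uv eq_sym.
Qed.

Lemma ler_enormD u v : enorm (u + v) <= enorm u + enorm v.
Proof. exact: (enormD u v).1. Qed.

Lemma enorm_dist u v w : enorm (u - w) <= enorm (u - v) + enorm (v - w).
Proof. by rewrite -[u - w](subrKA v) ler_enormD. Qed.

(** Affine independence will exclude the proportionality; this is how detours and edges become
    strictly shorter than the plain triangle inequality allows. *)
Lemma ltr_enorm_dist u v w :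
  enorm (v - w) *: (u - v) <> enorm (u - v) *: (v - w) ->
  enorm (u - w) < enorm (u - v) + enorm (v - w).
Proof.
move=> /eqP/negPf uvw; have [le_uw eq_uw] := enormD (u - v) (v - w).
rewrite -[u - w](subrKA v) lt_neqAle le_uw andbT.
by rewrite eq_uw uvw.
Qed.

Lemma enorm_midpointr u v : enorm (midpoint u v - v) = enorm (u - v) / 2.
Proof.
have -> : midpoint u v - v = 2^-1 *: (u - v).
  by apply/rowP => i; rewrite !mxE; lra.
by rewrite enormZ ger0_norm ?invr_ge0// mulrC.
Qed.

Lemma enorm_midpointl u v : enorm (midpoint u v - u) = enorm (u - v) / 2.
Proof.
by rewrite /midpoint (addrC u v) -/(midpoint v u) enorm_midpointr enormB.
Qed.

Lemma enorm_continuous : continuous (@enorm R).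
Proof.
move=> u; apply: continuous_comp; last exact: sqrt_continuous.
apply: continuous_big => [|i _ v]; first exact: add_continuous.
by apply: continuousM; exact: coord_continuous.
Qed.
End Euclidean.

(** * Lengths of curves and the intrinsic distance *)

Section Paths.
Variable R : realType.
Implicit Types (S : set 'rV[R]_3) (x y p q : 'rV[R]_3).

(** The increments of [phi] telescope along any partition. *)
Lemma curve_length_le (g : R -> 'rV[R]_3) (phi : R -> R) a b :
  (forall s t, s <= t -> enorm (g t - g s) <= phi t - phi s) ->
  (curve_length a b g <= (phi b - phi a)%:E)%E.
Proof.
move=> gphi; apply: ge_ereal_sup => _ [s [sab /eqP sb] <-].
rewrite lee_fin /polygonal_length /=.
have -> : phi b - phi a =
    \sum_(0 <= n < size s) (phi (nth b (a :: s) n.+1) - phi (nth b (a :: s) n)).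
  by rewrite telescope_sumr// -last_nth sb.
apply: ler_sum_nat => n /andP[_ ns].
by apply/gphi/ltW; have /pathP := sab; apply.
Qed.

Lemma curve_length_ge (g : R -> 'rV[R]_3) a b : a < b ->
  ((enorm (g a - g b))%:E <= curve_length a b g)%E.
Proof.
move=> ab; apply: ereal_sup_ubound; exists [:: b]; first exact: itv_partition1.
by rewrite /polygonal_length /= big_nat1 /= enormB.
Qed.

Lemma intrinsic_dist_ge S x y : ((enorm (x - y))%:E <= intrinsic_dist S x y)%E.
Proof.
by apply: le_ereal_inf_tmp => _ [g [_ <- <- _] <-]; apply: curve_length_ge.
Qed.

(** A ramp that is constant outside the unit interval: with shifted ramps, a broken line is given by
    a single continuous formula, without gluing. *)
Definition clamp01 (t : R) : R := Num.min (Num.max t 0) 1.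

Lemma clamp01_id t : 0 <= t <= 1 -> clamp01 t = t.
Proof. by rewrite /clamp01 => /andP[t0 t1]; rewrite max_l// min_l. Qed.

Lemma clamp01_le0 t : t <= 0 -> clamp01 t = 0.
Proof. by rewrite /clamp01 => t0; rewrite max_r// min_l. Qed.

Lemma clamp01_ge1 t : 1 <= t -> clamp01 t = 1.
Proof.
by rewrite /clamp01 => t1; rewrite max_l ?min_r// (le_trans ler01).
Qed.

Lemma le_clamp01 s t : s <= t -> clamp01 s <= clamp01 t.
Proof.
rewrite /clamp01 => st; rewrite le_min !ge_min lexx orbT andbT.
by rewrite ge_max !le_max st lexx orbT.
Qed.

Lemma clamp01_continuous : continuous clamp01.
Proof.
move=> t; apply: (@continuous_min _ R (fun t => Num.max t 0) (cst 1)).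
  apply: (@continuous_max _ R id (cst 0)); first exact: cvg_id.
  exact: cvg_cst.
exact: cvg_cst.
Qed.

(** Three segments suffice below, since paths cross at most two edges; shorter broken lines are
    obtained by repeating a point. *)
Lemma intrinsic_dist_le3 S x p q y :
  segment x p `<=` S -> segment p q `<=` S -> segment q y `<=` S ->
  (intrinsic_dist S x y <=
    (enorm (x - p) + enorm (p - q) + enorm (q - y))%:E)%E.
Proof.
move=> xpS pqS qyS.
(* Each ramp grows on one third of the unit interval, so [g] runs through the segments in turn and
   [phi] is the length travelled so far. *)
pose c1 (t : R) : R := clamp01 (3 * t).
pose c2 (t : R) : R := clamp01 (3 * t - 1).
pose c3 (t : R) : R := clamp01 (3 * t - 2).
pose g (t : R) : 'rV[R]_3 := x + c1 t *: (p - x) + c2 t *: (q - p) + c3 t *: (y - q).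
pose phi t :=
  c1 t * enorm (x - p) + c2 t * enorm (p - q) + c3 t * enorm (q - y).
have c0 : (c1 0 = 0) * (c2 0 = 0) * (c3 0 = 0).
  by rewrite /c1 /c2 /c3 !clamp01_le0//; lra.
have c1E : (c1 1 = 1) * (c2 1 = 1) * (c3 1 = 1).
  by rewrite /c1 /c2 /c3 !clamp01_ge1//; lra.
have cc (a b : R) : continuous (fun t : R => clamp01 (a * t - b)).
  move=> t; apply: (@continuous_comp _ _ _ (fun t : R => a * t - b) clamp01);
    last exact: clamp01_continuous.
  by apply: cvgB; [apply: cvgM; [exact: cvg_cst|exact: cvg_id]|exact: cvg_cst].
have -> : enorm (x - p) + enorm (p - q) + enorm (q - y) = phi 1 - phi 0.
  by rewrite /phi !c0 !c1E; ring.
apply: (@le_trans _ _ (curve_length 0 1 g)).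
  apply: ereal_inf_lbound; exists g => //; split.
  - apply: continuous_subspaceT => t; rewrite /g.
    apply: cvgD; [apply: cvgD; [apply: cvgD; [exact: cvg_cst|] |] |];
      apply: cvgZr_tmp.
    + by have := cc 3 0 t; under eq_fun do rewrite subr0.
    + exact: cc.
    + exact: cc.
  - by rewrite /g !c0 !scale0r !addr0.
  - by rewrite /g !c1E; apply/rowP => i; rewrite !mxE; ring.
  move=> t /=; rewrite in_itv /= => /andP[t0 t1].
  have [t3|t3] := leP t (1 / 3).
    apply: xpS; exists (3 * t); first by rewrite /= in_itv/=; lra.
    rewrite /g /c1 /c2 /c3 clamp01_id ?clamp01_le0; [|lra..].
    by apply/rowP => i; rewrite !mxE; ring.
  have [t23|t23] := leP t (2 / 3).
    apply: pqS; exists (3 * t - 1); first by rewrite /= in_itv/=; lra.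
    rewrite /g /c1 /c2 /c3 clamp01_ge1 ?[clamp01 (_ - 1)]clamp01_id
      ?clamp01_le0; [|lra..].
    by apply/rowP => i; rewrite !mxE; ring.
  apply: qyS; exists (3 * t - 2); first by rewrite /= in_itv/=; lra.
  rewrite /g /c1 /c2 /c3 [clamp01 (_ - 2)]clamp01_id ?clamp01_ge1; [|lra..].
  by apply/rowP => i; rewrite !mxE; ring.
apply: curve_length_le => s t st.
have -> : g t - g s = (c1 t - c1 s) *: (p - x) + (c2 t - c2 s) *: (q - p)
    + (c3 t - c3 s) *: (y - q).
  by rewrite /g; apply/rowP => i; rewrite !mxE; ring.
have -> : phi t - phi s = (c1 t - c1 s) * enorm (p - x)
    + (c2 t - c2 s) * enorm (q - p) + (c3 t - c3 s) * enorm (y - q).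
  by rewrite /phi (enormB x p) (enormB p q) (enormB q y); ring.
rewrite (le_trans (ler_enormD _ _))// lerD//.
  rewrite (le_trans (ler_enormD _ _))// lerD//;
    rewrite enormZ ger0_norm// subr_ge0 le_clamp01//; lra.
by rewrite enormZ ger0_norm// subr_ge0 le_clamp01//; lra.
Qed.

End Paths.

(** * Paths across faces, bounded by affine functions of barycentric coordinates *)

Section Triangles.
Variable R : realType.
Implicit Types (S : set 'rV[R]_3) (A B C D x y p q : 'rV[R]_3).

Lemma enorm_comb3 (a b c : R) (u v w : 'rV[R]_3) :
  0 <= a -> 0 <= b -> 0 <= c ->
  enorm (a *: u + b *: v + c *: w) <= a * enorm u + b * enorm v + c * enorm w.
Proof.
move=> a0 b0 c0.
by rewrite !(le_trans (ler_enormD _ _))// lerD ?(le_trans (ler_enormD _ _))//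
  ?lerD// enormZ ger0_norm.
Qed.

Lemma segmentE x y p : segment x y p <->
  exists t : R, [/\ 0 <= t, t <= 1 & p = (1 - t) *: x + t *: y].
Proof.
split=> [[t /=]|[t [t0 t1 ->]]]; last by exists t; rewrite //= in_itv/= t0.
by rewrite in_itv /= => /andP[t0 t1] <-; exists t.
Qed.

Definition triangle A B C : set 'rV[R]_3 :=
  [set x | exists a b c : R, [/\ 0 <= a, 0 <= b, 0 <= c, a + b + c = 1
    & x = a *: A + b *: B + c *: C]].

Lemma triangle_rot A B C : triangle B C A = triangle A B C.
Proof.
apply/seteqP; split=> x [a [b [c [a0 b0 c0 abc ->]]]].
  by exists c, a, b; split=> //; [lra|rewrite addrC addrA].
by exists b, c, a; split=> //; [lra|rewrite [RHS]addrC addrA].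
Qed.

Lemma triangle_swap A B C : triangle B A C = triangle A B C.
Proof.
apply/seteqP; split=> x [a [b [c [a0 b0 c0 abc ->]]]];
  by exists b, a, c; split=> //; [lra|rewrite (addrC (_ *: _))].
Qed.

Lemma triangle_segment A B C x y : triangle A B C x -> triangle A B C y ->
  segment x y `<=` triangle A B C.
Proof.
move=> [a [b [c [a0 b0 c0 abc ->]]]] [a' [b' [c' [a'0 b'0 c'0 abc' ->]]]].
move=> _ /segmentE[t [t0 t1 ->]].
have t'0 : 0 <= 1 - t by lra.
exists ((1 - t) * a + t * a'), ((1 - t) * b + t * b'), ((1 - t) * c + t * c').
split; [by rewrite addr_ge0// mulr_ge0..| |].
  transitivity ((1 - t) * (a + b + c) + t * (a' + b' + c')); first by ring.
  by rewrite abc abc'; ring.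
by apply/rowP => i; rewrite !mxE; ring.
Qed.

(** The distance to [x] is convex, hence largest at a vertex. *)
Lemma enorm_triangle_le A B C x y r : triangle A B C y ->
  enorm (x - A) <= r -> enorm (x - B) <= r -> enorm (x - C) <= r ->
  enorm (x - y) <= r.
Proof.
move=> [a [b [c [a0 b0 c0 abc ->]]]] xA xB xC.
have -> : x - (a *: A + b *: B + c *: C) =
    a *: (x - A) + b *: (x - B) + c *: (x - C).
  rewrite -{1}[x]scale1r -abc.
  by apply/rowP => i; rewrite !mxE; ring.
apply: (le_trans (enorm_comb3 _ _ _ a0 b0 c0)).
rewrite -[r]mul1r -abc !mulrDl.
by rewrite !lerD// ler_wpM2l.
Qed.

Lemma dist_le_triangle S A B C x y : triangle A B C `<=` S ->
  triangle A B C x -> triangle A B C y ->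
  (intrinsic_dist S x y <= (enorm (x - y))%:E)%E.
Proof.
move=> ABC xT yT.
have sub u v : triangle A B C u -> triangle A B C v -> segment u v `<=` S.
  by move=> uT vT; apply: subset_trans ABC; exact: triangle_segment.
have := intrinsic_dist_le3 (sub _ _ xT xT) (sub _ _ xT xT) (sub _ _ xT yT).
by rewrite subrr enorm0 !add0r.
Qed.

(** The affine map fixing [B] and [C] and sending [D] to [p] takes the end point to a point [q] of
    [BC]. The path goes straight to [q], a length bounded by convexity, then parallel to [pD] over
    the length [d |pD|]. *)
Lemma dist_le_across_edge S A B C D x p (b c d : R) :
  triangle A B C `<=` S -> triangle B C D `<=` S ->
  triangle A B C x -> segment B C p ->
  0 <= b -> 0 <= c -> 0 <= d -> b + c + d = 1 ->
  (intrinsic_dist S x (b *: B + c *: C + d *: D) <=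
   (b * enorm (x - B) + c * enorm (x - C)
      + d * (enorm (x - p) + enorm (p - D)))%:E)%E.
Proof.
move=> ABC BCD xT /segmentE[t [t0 t1 ->]] b0 c0 d0 bcd; set p' := _ + t *: C.
pose q := b *: B + c *: C + d *: p'.
have qE : q = (b + d * (1 - t)) *: B + (c + d * t) *: C.
  by rewrite /q /p'; apply/rowP => i; rewrite !mxE; ring.
have b'0 : 0 <= b + d * (1 - t) by rewrite addr_ge0// mulr_ge0// subr_ge0.
have c'0 : 0 <= c + d * t by rewrite addr_ge0// mulr_ge0.
have q1 : triangle A B C q.
  exists 0, (b + d * (1 - t)), (c + d * t); split=> //; last first.
    by rewrite qE scale0r add0r.
  by lra.
have q2 : triangle B C D q.
  exists (b + d * (1 - t)), (c + d * t), 0; split=> //; last first.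
    by rewrite qE scale0r addr0.
  by lra.
have y2 : triangle B C D (b *: B + c *: C + d *: D) by exists b, c, d.
apply: (le_trans (intrinsic_dist_le3 (p := q) (q := q) _ _ _)).
- by apply: subset_trans ABC; exact: triangle_segment.
- by apply: subset_trans ABC; exact: triangle_segment.
- by apply: subset_trans BCD; exact: triangle_segment.
rewrite lee_fin subrr enorm0 addr0 mulrDr addrA lerD//.
  have -> : x - q = b *: (x - B) + c *: (x - C) + d *: (x - p').
    rewrite -{1}[x]scale1r -bcd /q.
    by apply/rowP => i; rewrite !mxE; ring.
  exact: enorm_comb3.
have -> : q - (b *: B + c *: C + d *: D) = d *: (p' - D).
  by rewrite /q; apply/rowP => i; rewrite !mxE; ring.
by rewrite enormZ ger0_norm.
Qed.

(** The path crosses [AB] at [(b + c) B + d p] and [BD] at [(b + c) B + d D]. Its second leg is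
    parallel to [pD] with ratio [d], its third leg parallel to [BC] with ratio [c]. *)
Lemma dist_le_across_two_edges S A B C D x p (b c d : R) :
  triangle A B C `<=` S -> triangle A B D `<=` S -> triangle B C D `<=` S ->
  triangle A B C x -> segment A B p ->
  0 <= b -> 0 <= c -> 0 <= d -> b + c + d = 1 ->
  (intrinsic_dist S x (b *: B + c *: C + d *: D) <=
   (b * enorm (x - B) + c * (enorm (x - B) + enorm (B - C))
      + d * (enorm (x - p) + enorm (p - D)))%:E)%E.
Proof.
move=> ABC ABD BCD xT /segmentE[t [t0 t1 ->]] b0 c0 d0 bcd; set p' := _ + t *: B.
pose p1 := (b + c) *: B + d *: p'; pose q1 := (b + c) *: B + d *: D.
have p1E : p1 = (d * (1 - t)) *: A + (b + c + d * t) *: B.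
  by rewrite /p1 /p'; apply/rowP => i; rewrite !mxE; ring.
have a'0 : 0 <= d * (1 - t) by rewrite mulr_ge0// subr_ge0.
have b'0 : 0 <= b + c + d * t by rewrite !addr_ge0// mulr_ge0.
have bc0 : 0 <= b + c by rewrite addr_ge0.
have pABX X : triangle A B X p1.
  exists (d * (1 - t)), (b + c + d * t), 0; split=> //; last first.
    by rewrite p1E scale0r addr0.
  by lra.
have qABD : triangle A B D q1.
  by exists 0, (b + c), d; split; rewrite // ?add0r// scale0r add0r.
have qBCD : triangle B C D q1.
  by exists (b + c), 0, d; split; rewrite // ?addr0// scale0r addr0.
have yBCD : triangle B C D (b *: B + c *: C + d *: D) by exists b, c, d.
apply: (le_trans (intrinsic_dist_le3 (p := p1) (q := q1) _ _ _)).
- by apply: subset_trans ABC; exact: triangle_segment.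
- by apply: subset_trans ABD; exact: triangle_segment.
- by apply: subset_trans BCD; exact: triangle_segment.
rewrite lee_fin.
have -> : p1 - q1 = d *: (p' - D) 
  by rewrite /p1 /q1; apply/rowP => i; rewrite !mxE; ring.
have -> : q1 - (b *: B + c *: C + d *: D) = c *: (B - C).
  by rewrite /q1; apply/rowP => i; rewrite !mxE; ring.
rewrite !enormZ !ger0_norm//.
suff : enorm (x - p1) <=
  b * enorm (x - B) + c * enorm (x - B) + d * enorm (x - p') by lra.
have -> : x - p1 = b *: (x - B) + c *: (x - B) + d *: (x - p').
  rewrite -{1}[x]scale1r -bcd /p1.
  by apply/rowP => i; rewrite !mxE; ring.
exact: enorm_comb3.
Qed.

(** Stated on points rather than indices, so that the vertices can be relabelled in the lemmas
    below. *)
Definition aff_free A B C D : Prop := forall a b c d : R,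
  a + b + c + d = 0 -> a *: A + b *: B + c *: C + d *: D = 0 ->
  [/\ a = 0, b = 0, c = 0 & d = 0].

(** The witness is the point where the line [Ax] meets [BC]; since [x - p] is [a / (1 - a)] times
    [A - x], the bound follows from [|pD| <= |px| + |xD|]. *)
Lemma exists_short_detour A B C D x (a b c r : R) : aff_free A B C D ->
  0 <= a -> a < 1 -> 0 <= b -> 0 <= c -> a + b + c = 1 ->
  x = a *: A + b *: B + c *: C -> enorm (x - A) <= r -> enorm (x - D) <= r ->
  exists p, [/\ segment B C p,
    enorm (x - p) + enorm (p - D) <= (2 * (a / (1 - a)) + 1) * r &
    0 < a -> enorm (x - p) + enorm (p - D) < (2 * (a / (1 - a)) + 1) * r].
Proof.
move=> free a0 a1 b0 c0 abc xE xA xD.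
have a'0 : 0 < 1 - a by lra.
have a'N0 : 1 - a != 0 by rewrite gt_eqF.
pose b' := b / (1 - a); pose c' := c / (1 - a).
have bE : b = (1 - a) * b' by rewrite mulrC divfK.
have cE : c = (1 - a) * c' by rewrite mulrC divfK.
have c'0 : 0 <= c' by rewrite divr_ge0// ltW.
have bc' : b' = 1 - c'.
  by apply: (mulfI a'N0); rewrite mulrBr mulr1 -bE -cE; lra.
have b'0 : 0 <= b' by rewrite divr_ge0// ltW.
pose p := b' *: B + c' *: C.
have xp : x - p = (a / (1 - a)) *: (A - x).
  apply/(scalerI a'N0); rewrite scalerA [_ * (a / _)]mulrC divfK//.
  rewrite xE /p bE cE.
  by apply/rowP => i; rewrite !mxE bc'; ring.
have nxp : enorm (x - p) <= a / (1 - a) * r.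
  rewrite xp enormZ ger0_norm ?divr_ge0// ?(ltW a'0)//.
  by rewrite enormB ler_wpM2l// divr_ge0// ltW.
have := enorm_dist p x D; rewrite (enormB p x) => pD.
exists p; split.
- by apply/segmentE; exists c'; split; rewrite // -?bc'//; lra.
- lra.
move=> apos; suff : enorm (p - D) < enorm (p - x) + enorm (x - D).
  by rewrite (enormB p x); lra.
(* In the equality case, the coefficient [t] of [D] vanishes, so [p = x]; comparing the coefficients
   of [A] then gives [a = 0]. *)
apply: ltr_enorm_dist; set s := enorm (x - D); set t := enorm (p - x) => E.
have [||_ _ _ t0] := free (- (s + t) * a) (s * b' - (s + t) * b)
    (s * c' - (s + t) * c) t.
- have -> : a = 1 - b - c by lra.
  by rewrite bc'; ring.
- move/eqP: E; rewrite -subr_eq0 => /eqP <-; rewrite /p xE.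
  by apply/rowP => i; rewrite !mxE; ring.
have px : p - x = 0 by apply: enorm_eq0.
have [||aa _ _ _] := free a (b - b') (c - c') 0.
- by rewrite bc'; lra.
- rewrite -[RHS]oppr0 -px xE /p.
  by apply/rowP => i; rewrite !mxE; ring.
by move: apos; rewrite aa ltxx.
Qed.

(** As [a > 0], the point [x] is off the line [BC], so the triangle inequality through [x] is
    strict. *)
Lemma enorm_edge_lt A B C D x (a b c r : R) : aff_free A B C D -> 0 < a ->
  a + b + c = 1 -> x = a *: A + b *: B + c *: C ->
  enorm (x - B) <= r -> enorm (x - C) <= r -> enorm (B - C) < 2 * r.
Proof.
move=> free a0 abc xE xB xC.
suff : enorm (B - C) < enorm (B - x) + enorm (x - C).
  by rewrite (enormB B x); lra.
apply: ltr_enorm_dist; set s := enorm (x - C); set t := enorm (B - x) => E.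
have [||/eqP + sB tC _] := free ((s + t) * a) ((s + t) * b - s)
    ((s + t) * c - t) 0.
- have -> : a = 1 - b - c by lra.
  by ring.
- rewrite -[RHS]oppr0; move/eqP: E; rewrite -subr_eq0 => /eqP <-; rewrite xE.
  by apply/rowP => i; rewrite !mxE; ring.
rewrite mulf_eq0 (gt_eqF a0) orbF => /eqP st.
have := enorm_ge0 (x - C); have := enorm_ge0 (B - x); rewrite -/s -/t => t0 s0.
have /enorm_eq0 Bx : t = 0 by lra.
have /enorm_eq0 xC0 : s = 0 by lra.
have BC : B - C = 0 by rewrite -(subrKA x) Bx xC0 addr0.
have [||_ /eqP + _ _] := free 0 1 (- 1) 0; first by lra.
  by rewrite -[RHS]BC; apply/rowP => i; rewrite !mxE; ring.
by rewrite oner_eq0.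
Qed.

(** Meant for the least weight [c] and the middle weight [m] of three weights with sum 1. Clearing
    denominators and doubling leaves [(2 - 3c)(1 - c - 2m) + c(1 - 3c) >= 0], where [c <= 1/3]. *)
Lemma sum_odds_le1 (c m : R) : 0 <= c -> c <= m -> c + 2 * m <= 1 ->
  c / (1 - c) + m / (1 - m) <= 1.
Proof.
move=> c0 cm cm1.
have c1 : 0 < 1 - c by lra.
have m1 : 0 < 1 - m by lra.
rewrite addf_div ?gt_eqF// ler_pdivrMr ?mulr_gt0//.
have : 0 <= (2 - 3 * c) * (1 - c - 2 * m) by rewrite mulr_ge0//; lra.
have : 0 <= c * (1 - 3 * c) by rewrite mulr_ge0//; lra.
by lra.
Qed.

(* With [G_u] the length of the detour to [D] opposite to the vertex of weight
   [u], the affine bounds take at [B, C, D] the values [r, r, G_a] (across [BC]),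
   [r, r + |BC|, G_c] (across [AB] and [BD]) and [r + |BC|, r, G_b] (across [AC]
   and [CD]). The first one suffices when [a] is the least weight; otherwise
   the second is averaged with the first or the third, according to whether
   [a <= b]. *)
Lemma side_face_bound S A B C D x (a b c r : R) : aff_free A B C D ->
  triangle A B C `<=` S -> triangle A B D `<=` S ->
  triangle A C D `<=` S -> triangle B C D `<=` S ->
  0 <= a -> 0 <= b -> 0 <= c -> a + b + c = 1 ->
  x = a *: A + b *: B + c *: C ->
  enorm (x - A) <= r -> enorm (x - B) <= r -> enorm (x - C) <= r ->
  enorm (x - D) <= r -> 0 < r -> c <= b ->
  exists2 M, M < 2 * r &
    forall y, triangle B C D y -> (intrinsic_dist S x y <= M%:E)%E.
Proof.
move=> free ABC ABD ACD BCD a0 b0 c0 abc xE xA xB xC xD r0 cb.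
have xT : triangle A B C x by exists a, b, c.
have [ac|ca] := leP a c.
  have [|p [pBC len lts]] :=
    exists_short_detour free a0 _ b0 c0 abc xE xA xD; first by lra.
  set G := enorm (x - p) + _ in len lts.
  have Gr : G < 2 * r.
    (* The detour estimate is strict only for [a > 0]; for [a = 0] the weak one already reads
       [G <= r]. *)
    have [apos|aneg] := ltP 0 a.
      apply: (lt_le_trans (lts apos)); rewrite ler_wpM2r ?(ltW r0)//.
      suff : a / (1 - a) <= 1 / 2 by lra.
      by rewrite ler_pdivrMr; lra.
    have a00 : a = 0 by lra.
    by move: len; rewrite a00 mul0r mulr0; lra.
  exists (Num.max r G); first by rewrite gt_max Gr; lra.
  move=> _ [b' [c' [d' [b'0 c'0 d'0 bcd ->]]]].
  apply: (le_trans (dist_le_across_edge ABC BCD xT pBC b'0 c'0 d'0 bcd)).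
  rewrite lee_fin -[leRHS]mul1r -bcd !mulrDl -/G.
  by rewrite !lerD// ler_wpM2l// le_max ?xB ?xC// lexx orbT.
have BC := enorm_edge_lt free (le_lt_trans c0 ca) abc xE xB xC.
set N := enorm (B - C) in BC.
have [q [qAB lenq ltsq]] : exists p, [/\ segment A B p,
    enorm (x - p) + enorm (p - D) <= (2 * (c / (1 - c)) + 1) * r &
    0 < c -> enorm (x - p) + enorm (p - D) < (2 * (c / (1 - c)) + 1) * r].
  apply: (@exists_short_detour C A B D x c a b) => //; [|lra|lra|].
    move=> s t u v stuv E; have [||-> -> -> ->//] := free t u s v; first lra.
    by rewrite -E; apply/rowP => i; rewrite !mxE; ring.
  by rewrite xE addrC addrA.
set H := enorm (x - q) + _ in lenq ltsq.
(* The average of the two affine bounds is at most [r + N / 2] at [B] and [C], and [(G + H) / 2] at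
   [D]. *)
pose M G := Num.max (r + N / 2) ((G + H) / 2).
have Mlt G m : 0 <= m -> c <= m -> c + 2 * m <= 1 ->
    G <= (2 * (m / (1 - m)) + 1) * r ->
    (0 < m -> G < (2 * (m / (1 - m)) + 1) * r) -> M G < 2 * r.
  move=> m0 cm cm1 len lts.
  (* Strictness comes from [G] when [m > 0]; otherwise [c = 0] too, and both detours are at most
     [r]. *)
  have GH : G + H < 4 * r.
    have [mpos|mneg] := ltP 0 m.
      have := ler_wpM2r (ltW r0) (sum_odds_le1 c0 cm cm1).
      have := lts mpos.
      by lra.
    have m00 : m = 0 by lra.
    have c00 : c = 0 by lra.
    move: len lenq; rewrite m00 c00 !mul0r mulr0.
    by lra.
  by rewrite gt_max; apply/andP; split; lra.
have average G (b' c' d' e : R) (rho : \bar R) :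
    0 <= b' -> 0 <= c' -> 0 <= d' -> b' + c' + d' = 1 ->
    (rho <= e%:E)%E ->
    (rho <= (b' * enorm (x - B) + c' * (enorm (x - B) + N) + d' * H)%:E)%E ->
    e <= b' * (r + N) + c' * r + d' * G -> (rho <= (M G)%:E)%E.
  move=> b'0 c'0 d'0 bcd rho1 rho2 eG.
  have M1 : r + N / 2 <= M G by rewrite le_max lexx.
  have M2 : (G + H) / 2 <= M G by rewrite le_max lexx orbT.
  have := ler_wpM2l b'0 M1; have := ler_wpM2l c'0 M1.
  have := ler_wpM2l d'0 M2; have := ler_wpM2l b'0 xB.
  have := ler_wpM2l c'0 xB => h1 h2 h3 h4 h5.
  have ME : M G = b' * M G + c' * M G + d' * M G by rewrite -!mulrDl bcd mul1r.
  (* The average of the two bounds is at most [M G], hence so is one of them. *)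
  have [eM|Me] := leP e (M G).
    by apply: (le_trans rho1); rewrite lee_fin.
  apply: (le_trans rho2); rewrite lee_fin.
  by lra.
have BCDq := dist_le_across_two_edges ABC ABD BCD xT qAB.
have [ab|ba] := leP a b.
  have [|p [pBC len lts]] :=
    exists_short_detour free a0 _ b0 c0 abc xE xA xD; first by lra.
  set G := enorm (x - p) + _ in len lts.
  exists (M G); first by apply: (Mlt _ a) => //; lra.
  move=> _ [b' [c' [d' [b'0 c'0 d'0 bcd ->]]]].
  apply: (average G b' c' d' _ _ b'0 c'0 d'0 bcd
    (dist_le_across_edge ABC BCD xT pBC b'0 c'0 d'0 bcd) (BCDq _ _ _ _ _ _ _)) => //.
  (* The bound across [BC] is relaxed by [b' * N] to fit the form that [average] expects. *)
  rewrite -/G.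
  have := ler_wpM2l b'0 xB; have := ler_wpM2l c'0 xC.
  have := ler_wpM2l b'0 (enorm_ge0 (B - C)); rewrite -/N.
  by lra.
have [p [pAC len lts]] : exists p, [/\ segment A C p,
    enorm (x - p) + enorm (p - D) <= (2 * (b / (1 - b)) + 1) * r &
    0 < b -> enorm (x - p) + enorm (p - D) < (2 * (b / (1 - b)) + 1) * r].
  apply: (@exists_short_detour B A C D x b a c) => //; [|lra|lra|].
    move=> s t u v stuv E; have [||-> -> -> ->] := free t s u v => //; first lra.
    by rewrite -[RHS]E (addrC (s *: B)).
  by rewrite xE (addrC (_ *: _) (b *: B)).
set G := enorm (x - p) + _ in len lts.
exists (M G); first by apply: (Mlt _ b) => //; lra.
move=> _ [b' [c' [d' [b'0 c'0 d'0 bcd ->]]]].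
(* The path across [AC] and [CD] is the two-edge path with [B] and [C] exchanged. *)
have cbd : c' + b' + d' = 1 by lra.
have CB : triangle A C B = triangle A B C by rewrite triangle_rot triangle_swap.
have := @dist_le_across_two_edges S A C B D x p c' b' d'.
rewrite CB (triangle_swap B C D) => /(_ ABC ACD BCD xT pAC c'0 b'0 d'0 cbd).
rewrite (addrC (c' *: C)) => ineq.
apply: (average G b' c' d' _ _ b'0 c'0 d'0 bcd ineq (BCDq _ _ _ _ _ _ _)) => //.
rewrite -/G (enormB C B) -/N.
have := ler_wpM2l b'0 xC; have := ler_wpM2l c'0 xC.
by lra.
Qed.

End Triangles.

(** * Enumerations of the four vertex indices *)

Lemma uniq4_perm i j k l : uniq [:: i; j; k; l] ->
  perm_eq (index_enum 'I_4) [:: i; j; k; l].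
Proof.
move=> u; rewrite perm_sym uniq_perm ?index_enum_uniq//.
have [m _||//] := @uniq_min_size _ _ (index_enum 'I_4) u.
  exact: mem_index_enum.
by rewrite /index_enum -enumT -cardE card_ord.
Qed.

Lemma mem_uniq4 i j k l (m : 'I_4) :
  uniq [:: i; j; k; l] -> m \in [:: i; j; k; l].
Proof. by move=> /uniq4_perm/perm_mem <-; exact: mem_index_enum. Qed.

Lemma sum_uniq4 (V : nmodType) (F : 'I_4 -> V) i j k l :
  uniq [:: i; j; k; l] -> \sum_m F m = F i + F j + F k + F l.
Proof.
move=> u; rewrite (perm_big _ (uniq4_perm u)).
by rewrite /= !big_cons big_nil addr0 !addrA.
Qed.

Lemma exists_uniq4 (i j : 'I_4) : i != j -> exists k l, uniq [:: i; j; k; l].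
Proof.
move=> ij; have : #|~: [set i; j]%SET| == 2%N.
  by rewrite -(eqn_add2l #|[set i; j]%SET|) cardsC cards2 ij card_ord.
move=> /cards2P[k [l [kl E]]]; exists k, l.
have : k \in ~: [set i; j]%SET by rewrite E !inE eqxx.
have : l \in ~: [set i; j]%SET by rewrite E !inE eqxx orbT.
rewrite !inE !negb_or => /andP[li lj] /andP[ki kj].
by rewrite /= !inE !negb_or ij kl !(eq_sym i) !(eq_sym j) ki kj li lj.
Qed.

Lemma exists_uniq4_head (i : 'I_4) : exists j k l, uniq [:: i; j; k; l].
Proof.
have /card_gt0P[j] : (0 < #|predC1 i|)%N by rewrite cardC1 card_ord.
by rewrite inE eq_sym => /exists_uniq4; exists j.
Qed.

(** * Barycentric coordinates on the faces of a tetrahedron *)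

Section Tetrahedra.
Variables (R : realType) (T : tetrahedron R).
Implicit Types (x y : 'rV[R]_3) (i j k l m : 'I_4).

(** Eliminating the weight of vertex [ord0] turns the relation into a row vector annihilating the
    row-free matrix of edges from that vertex. *)
Lemma vert_affine_free (w : 'I_4 -> R) :
  \sum_m w m = 0 -> \sum_m w m *: T m = 0 -> forall m, w m = 0.
Proof.
move=> w0 wT0; pose u : 'rV[R]_3 := \row_m w (lift ord0 m).
have wlift (m : 'I_3) : w (lift ord0 m) = 0.
  suff /rowP/(_ m) : u = 0 by rewrite !mxE.
  apply/eqP; rewrite -(mulmx_free_eq0 _ (vert_free T)); apply/eqP.
  have w00 : w ord0 = - \sum_(m' < 3) w (lift ord0 m').
    by move: w0; rewrite big_ord_recl => /eqP; rewrite addr_eq0 => /eqP.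
  rewrite mulmx_sum_row -[RHS]wT0 [RHS]big_ord_recl w00 scaleNr scaler_suml addrC.
  by rewrite -sumrB; apply: eq_bigr => m' _; rewrite rowK mxE scalerBr.
move=> m; case: (unliftP ord0 m) => [m' ->|->]; first exact: wlift.
by move: w0; rewrite big_ord_recl big1 ?addr0.
Qed.

Lemma vert_aff_free i j k l : uniq [:: i; j; k; l] ->
  aff_free (T i) (T j) (T k) (T l).
Proof.
move=> u a b c d abcd0 abcdT0.
pose w m := if m == i then a else if m == j then b else if m == k then c else d.
have [wi wj wk wl] : [/\ w i = a, w j = b, w k = c & w l = d].
  move: u; rewrite /= !inE !negb_or /w !eqxx -!andbA.
  rewrite !(eq_sym i) (eq_sym j k) (eq_sym j l) (eq_sym k l).
  move=> /andP[/negPf-> /andP[/negPf-> /andP[/negPf-> /andP[/negPf->]]]].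
  by move=> /andP[/negPf-> /andP[/negPf->]].
have w0 : forall m, w m = 0.
  by apply: vert_affine_free; rewrite (sum_uniq4 _ u) wi wj wk wl.
by rewrite -wi -wj -wk -wl !w0.
Qed.

Lemma face_triangle i j k l : uniq [:: i; j; k; l] ->
  face T i = triangle (T j) (T k) (T l).
Proof.
move=> u; apply/seteqP; split=> x.
  move=> [w [w0 wi0]]; rewrite !(sum_uniq4 _ u) wi0 scale0r !add0r => w1 ->.
  by exists (w j), (w k), (w l).
move=> [a [b [c [a0 b0 c0 abc ->]]]].
pose w m := if m == j then a else if m == k then b else if m == l then c else 0.
have [wi wj wk wl] : [/\ w i = 0, w j = a, w k = b & w l = c].
  move: u; rewrite /= !inE !negb_or /w !eqxx -!andbA.
  rewrite (eq_sym j k) (eq_sym j l) (eq_sym k l).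
  move=> /andP[/negPf-> /andP[/negPf-> /andP[/negPf-> /andP[/negPf->]]]].
  by move=> /andP[/negPf-> /andP[/negPf->]].
exists w; rewrite !(sum_uniq4 _ u) wi wj wk wl scale0r !add0r.
by split=> // m; rewrite /w; do !case: ifP.
Qed.

Lemma triangle_surface i j k l : uniq [:: i; j; k; l] ->
  triangle (T j) (T k) (T l) `<=` surface T.
Proof. by move=> u x xT; exists i; rewrite ?(face_triangle u). Qed.

Lemma vert_surface i : surface T (T i).
Proof.
have [k [l [m u]]] := exists_uniq4_head i.
(* After rotation [m] comes first, and [T i] is a vertex of the face opposite to it. *)
move: u; rewrite -(rotr_uniq 1) => u.
apply: (triangle_surface u); exists 1, 0, 0.
by split=> //; rewrite ?addr0// scale1r !scale0r !addr0.
Qed.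

Lemma enorm_surface_le x y r : surface T y ->
  (forall i, enorm (x - T i) <= r) -> enorm (x - y) <= r.
Proof.
move=> [i _] + xr; have [j [k [l u]]] := exists_uniq4_head i.
by rewrite (face_triangle u) => /enorm_triangle_le; apply.
Qed.

End Tetrahedra.

(** A lower bound at every point and an upper bound at a single one enclose the infimum; they also
    make it finite, so [fine] does not return its default value. *)
Lemma radius_between (R : realType) (S : set 'rV[R]_3)
    (d : 'rV[R]_3 -> 'rV[R]_3 -> \bar R) (lo hi : R) :
  (forall x, S x -> exists2 y, S y & (lo%:E <= d x y)%E) ->
  (exists2 x, S x & forall y, S y -> (d x y <= hi%:E)%E) ->
  lo <= radius S d <= hi.
Proof.
move=> lod [x0 Sx0 dhi]; rewrite /radius; set r := ereal_inf _.
have lor : (lo%:E <= r)%E.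
  apply: le_ereal_inf_tmp => _ [x Sx <-]; have [y Sy ley] := lod x Sx.
  by apply: (le_trans ley); apply: ereal_sup_ubound; exists y.
have rhi : (r <= hi%:E)%E.
  apply: (@le_trans _ _ (ereal_sup [set d x0 y | y in S])).
    by apply: ereal_inf_lbound; exists x0.
  by apply: ge_ereal_sup => _ [y Sy <-]; exact: dhi.
have rfin : r \is a fin_num.
  by rewrite fin_numE -ltNye -ltey (lt_le_trans (ltNyr lo))//
    (le_lt_trans rhi)// ltry.
by rewrite -!lee_fin fineK// lor.
Qed.

(** * Existence of an extrinsic centre *)

Section Vertices.
Variables (R : realType) (T : tetrahedron R).

(** By convexity this is the largest distance from [x] to the surface; the default 0 is harmless
    because norms are nonnegative. *)
Definition vert_dist (x : 'rV[R]_3) : R :=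
  \big[Num.max/0]_(i < 4) enorm (x - T i).

Lemma vert_dist_continuous : continuous vert_dist.
Proof.
apply: continuous_big => [|i _ x]; first exact: max_continuous.
apply: (@continuous_comp _ _ _ (fun y : 'rV[R]_3 => y - T i) (@enorm R));
    last exact: enorm_continuous.
by apply: (@cvgB R 'rV[R]_3 _ (nbhs x) _ id); [exact: cvg_id|exact: cvg_cst].
Qed.

Lemma exists_extrinsic_center :
  exists2 x, surface T x & forall y, surface T y -> vert_dist x <= vert_dist y.
Proof.
pose P (w : 'rV[R]_4) := \sum_m w 0 m *: T m.
(* [K] is the boundary of the standard simplex: the vanishing product says that some coordinate is
   0. Its image [surface T] is therefore compact. *)
pose K := [set w : 'rV[R]_4 | forall m, `[0, 1]%classic (w 0 m)] `&`
  ([set w | \sum_m w 0 m = 1] `&` [set w | \prod_m w 0 m = 0]).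
have PK : P @` K = surface T.
  apply/seteqP; split=> x.
    move=> [w [/= w01 [w1 /eqP]]]; rewrite prodf_seq_eq0 => /hasP[i _ /= /eqP wi0].
    move=> <-; exists i => //; exists (fun m => w 0 m); split=> // m.
    by have := w01 m; rewrite in_itv /= => /andP[].
  move=> [i _ [w [w0 wi0 w1 ->]]]; exists (\row_m w m); last first.
    by apply: eq_bigr => m _; rewrite mxE.
  split=> [m|]; rewrite /= ?mxE ?in_itv/= ?w0.
    rewrite -w1 (bigD1 m)//= lerDl sumr_ge0//.
  split; first by rewrite -w1; apply: eq_bigr => m _; rewrite mxE.
  by rewrite (bigD1 i)//= mxE wi0 mul0r.
have cP : continuous P.
  apply: continuous_big => [|m _ w]; first exact: add_continuous.
  exact: cvgZr_tmp (@coord_continuous R 1 4 0 m w).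
have cK : compact K.
  apply: compact_closedI.
    by apply: (@rV_compact R 4 (fun=> `[0, 1]%classic)) => _; exact: segment_compact.
  apply: closedI.
    apply: (@closed_comp _ _ (fun w : 'rV[R]_4 => \sum_m w 0 m) [set r : R | r = 1]).
      move=> w _; apply: continuous_big => [|m _]; first exact: add_continuous.
      exact: coord_continuous.
    exact: closed_eq.
  apply: (@closed_comp _ _ (fun w : 'rV[R]_4 => \prod_m w 0 m) [set r : R | r = 0]).
    move=> w _; apply: continuous_big => [|m _]; first exact: mul_continuous.
    exact: coord_continuous.
  exact: closed_eq.
have [|||x xS xmin] := @EVT_min_rV R 3 vert_dist (surface T).
- by exists (T ord0); exact: vert_surface.
- by rewrite -PK; apply: continuous_compact cK; exact: continuous_subspaceT.
- exact/continuous_subspaceT/vert_dist_continuous.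
by exists x; [rewrite inE in xS|move=> y yS; apply: xmin; rewrite inE].
Qed.

End Vertices.

(** * Comparison of the two radii *)

Section Radii.
Variables (R : realType) (T : tetrahedron R).
Implicit Types (x y : 'rV[R]_3) (i j k l m : 'I_4).

(** A uniform [M] is required, since pointwise strict bounds could be lost in the supremum over [y];
    it is the maximum of one constant per face. *)
Lemma extrinsic_center_bound x r i : surface T x ->
  (forall m, enorm (x - T m) <= r) -> face T i x -> 0 < r ->
  exists2 M, M < 2 * r &
    forall y, surface T y -> (intrinsic_dist (surface T) x y <= M%:E)%E.
Proof.
move=> xS xr xi r0.
have face_bound m : exists M, M < 2 * r /\
    forall y, face T m y -> (intrinsic_dist (surface T) x y <= M%:E)%E.
  have [<-|im] := eqVneq i m.
    exists r; split=> [|y yi]; first by lra.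
    have yS : surface T y by exists i.
    have [j [k [l u]]] := exists_uniq4_head i.
    rewrite (face_triangle T u) in xi yi.
    apply: (le_trans (dist_le_triangle (triangle_surface u) xi yi)).
    by rewrite lee_fin (enorm_surface_le yS).
  have [k [l u]] := exists_uniq4 im.
  have U s : perm_eq [:: i; m; k; l] s -> uniq s by move=> /perm_uniq <-.
  have Uk : uniq [:: k; m; l; i] by apply: U; apply/permP => a /=; lia.
  have Ul : uniq [:: l; m; k; i] by apply: U; apply/permP => a /=; lia.
  have Um : uniq [:: m; k; l; i] by apply: U; apply/permP => a /=; lia.
  have Um' : uniq [:: m; l; k; i] by apply: U; apply/permP => a /=; lia.
  have Ui : uniq [:: i; m; l; k] by apply: U; apply/permP => a /=; lia.
  move: (xi); rewrite (face_triangle T u) => -[a [b [c [a0 b0 c0 abc xE]]]].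
  (* Here [T m] plays the role of [A] and [T i] that of [D]; [k] and [l] are ordered by weight. *)
  have [cb|bc] := leP c b.
    have [||||||M Mr HM] := side_face_bound (vert_aff_free Um)
      (triangle_surface u) (triangle_surface Ul) (triangle_surface Uk)
      (triangle_surface Um) a0 b0 c0 abc xE (r := r) => //.
    by exists M; rewrite (face_triangle T Um).
  have acb : a + c + b = 1 by lra.
  have xE' : x = a *: T m + c *: T l + b *: T k by rewrite xE addrAC.
  have [||||||M Mr HM] := side_face_bound (vert_aff_free Um')
    (triangle_surface Ui) (triangle_surface Uk) (triangle_surface Ul)
    (triangle_surface Um') a0 c0 b0 acb xE' (r := r) => //.
    exact: ltW.
  by exists M; rewrite (face_triangle T Um').
have [M HM] := choice face_bound.
exists (\big[Num.max/0]_m M m).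
  by apply: bigmax_lt => [|m _]; [lra|exact: (HM m).1].
move=> y [m _ ym]; apply: (le_trans ((HM m).2 y ym)).
by rewrite lee_fin le_bigmax.
Qed.

(** By minimality of the centre, every point of the surface is at distance at least [r] from some
    vertex, which bounds both radii below. The intrinsic radius is bounded above by testing it at
    the extrinsic centre. *)
Lemma intrinsic_radius_lt_double :
  0 < extrinsic_radius (surface T) /\
  extrinsic_radius (surface T) <= intrinsic_radius (surface T)
    < 2 * extrinsic_radius (surface T).
Proof.
have [x xS xmin] := exists_extrinsic_center T.
pose r := vert_dist T x.
have xr m : enorm (x - T m) <= r by exact: le_bigmax.
have r0 : 0 < r.
  rewrite ltNge; apply/negP => r0.
  have xT m : x = T m.
    apply/subr0_eq/enorm_eq0/eqP.
    by rewrite eq_le enorm_ge0 andbT (le_trans (xr m)).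
  have [k [l u]] := @exists_uniq4 ord0 ord_max isT.
  have [||/eqP + _ _ _] := @vert_aff_free R T _ _ _ _ u 1 (-1) 0 0.
  - by lra.
  - by rewrite -!xT !scale0r !addr0 scaleN1r scale1r subrr.
  by rewrite oner_eq0.
have far y : surface T y -> exists m, r <= enorm (y - T m).
  move=> yS; have /bigmax_geP[|[m _ rm]] := xmin y yS; last by exists m.
  by rewrite leNgt r0.
have extE : extrinsic_radius (surface T) = r.
  apply/eqP; rewrite eq_le andbC; apply: radius_between => [y yS|].
    have [m rm] := far y yS.
    by exists (T m); [exact: vert_surface|rewrite lee_fin].
  by exists x => // y yS; rewrite lee_fin (enorm_surface_le yS).
have [i _ xi] := xS.
have [M Mr HM] := extrinsic_center_bound xS xr xi r0.
have /andP[lo hi] : r <= intrinsic_radius (surface T) <= M.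
  apply: radius_between => [y yS|]; last by exists x.
  have [m rm] := far y yS; exists (T m); first exact: vert_surface.
  by apply: le_trans (intrinsic_dist_ge _ _ _); rewrite lee_fin.
by rewrite extE r0 lo (le_lt_trans hi).
Qed.

(** Any point is at distance at least [h] from [T i] or [T j]. Conversely [M] reaches the two faces
    containing it by straight segments, and each of the other two across an edge ending at [T k]. *)
Lemma radii_thick i j k l (h := enorm (T i - T j) / 2)
    (M := midpoint (T i) (T j)) : uniq [:: i; j; k; l] ->
  enorm (M - T k) <= h -> enorm (M - T l) <= h ->
  enorm (M - T k) + enorm (T k - T l) <= h ->
  extrinsic_radius (surface T) = h /\ intrinsic_radius (surface T) = h.
Proof.
move=> u Mk Ml Mkl.
have h0 : 0 <= h by rewrite divr_ge0 ?enorm_ge0.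
have Mi : enorm (M - T i) = h := enorm_midpointl _ _.
have Mj : enorm (M - T j) = h := enorm_midpointr _ _.
have U s : perm_eq [:: i; j; k; l] s -> uniq s by move=> /perm_uniq <-.
have Uk : uniq [:: k; i; j; l] by apply: U; apply/permP => a /=; lia.
have Ul : uniq [:: l; i; j; k] by apply: U; apply/permP => a /=; lia.
have Ul' : uniq [:: l; j; i; k] by apply: U; apply/permP => a /=; lia.
have Uj : uniq [:: j; i; k; l] by apply: U; apply/permP => a /=; lia.
have Mij n : triangle (T i) (T j) (T n) M.
  exists (1 / 2), (1 / 2), 0; split=> //; [by lra..|].
  by rewrite scale0r addr0 div1r -scalerDr.
have MS : surface T M by exact: (triangle_surface Ul).
have Mvert n : enorm (M - T n) <= h.
  by have := mem_uniq4 n u; rewrite !inE => /or4P[] /eqP ->; rewrite ?Mi ?Mj.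
have far y : exists2 n, n \in [:: i; j] & h <= enorm (y - T n).
  have := enorm_dist (T i) y (T j); rewrite (enormB (T i) y).
  have [hi|hi] := leP h (enorm (y - T i)).
    by exists i; rewrite // !inE eqxx.
  exists j; first by rewrite !inE eqxx orbT.
  by move: hi; rewrite /h; lra.
have edge n (a b c : R) : 0 <= a -> 0 <= b -> 0 <= c -> a + b + c = 1 ->
   enorm (M - T n) = h ->
   a * enorm (M - T n) + b * enorm (M - T k) + c * (enorm (M - T k)
    + enorm (T k - T l)) <= h.
  move=> a0 b0 c0 abc ->.
  have := ler_wpM2l b0 Mk; have := ler_wpM2l c0 Mkl.
  have : h = a * h + b * h + c * h by rewrite -!mulrDl abc mul1r.
  by lra.
have near y : surface T y -> (intrinsic_dist (surface T) M y <= h%:E)%E.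
  move=> yS; have [n _ yn] := yS.
  (* Taking [T k] itself as crossing point makes the affine bound at most [h] at all three
     vertices. *)
  have Tkk m : segment (T m) (T k) (T k).
    by apply/segmentE; exists 1; rewrite subrr scale0r add0r scale1r.
  have := mem_uniq4 n u; rewrite !inE => /or4P[] /eqP nE; move: yn; rewrite nE.
  - rewrite (face_triangle T u) => -[a [b [c [a0 b0 c0 abc ->]]]].
    apply: (le_trans (dist_le_across_edge (triangle_surface Ul)
      (triangle_surface u) (Mij k) (Tkk j) a0 b0 c0 abc)).
    by rewrite lee_fin edge.
  - rewrite (face_triangle T Uj) => -[a [b [c [a0 b0 c0 abc ->]]]].
    have MT : triangle (T j) (T i) (T k) M by rewrite triangle_swap.
    apply: (le_trans (dist_le_across_edge (triangle_surface Ul')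
      (triangle_surface Uj) MT (Tkk i) a0 b0 c0 abc)).
    by rewrite lee_fin edge.
  - rewrite (face_triangle T Uk) => yT.
    apply: (le_trans (dist_le_triangle (triangle_surface Uk) (Mij l) yT)).
    by rewrite lee_fin (enorm_surface_le yS).
  - rewrite (face_triangle T Ul) => yT.
    apply: (le_trans (dist_le_triangle (triangle_surface Ul) (Mij k) yT)).
    by rewrite lee_fin (enorm_surface_le yS).
split; apply/eqP; rewrite eq_le andbC; apply: radius_between.
- move=> y _; have [n _ hn] := far y.
  by exists (T n); [exact: vert_surface|rewrite lee_fin].
- by exists M => // y yS; rewrite lee_fin (enorm_surface_le yS).
- move=> y _; have [n _ hn] := far y; exists (T n); first exact: vert_surface.
  by apply: le_trans (intrinsic_dist_ge _ _ _); rewrite lee_fin.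
- by exists M.
Qed.

(** Convexity is applied once in each variable to move both points to vertices. *)
Lemma extrinsic_diam_le i j : longest_edge T i j ->
  extrinsic_diam (surface T) <= enorm (T i - T j).
Proof.
move=> [_ long]; apply: ge_sup.
  exists (enorm (T i - T j)), (T i); first exact: vert_surface.
  by exists (T j); first exact: vert_surface.
move=> _ [x xS [y yS <-]]; apply: (enorm_surface_le yS) => m.
rewrite enormB; apply: (enorm_surface_le xS) => n.
have [->|mn] := eqVneq m n; last exact: long.
by rewrite subrr enorm0 enorm_ge0.
Qed.

(** The diameter is at most [2 * h], so the ball has radius at most [h / 6]; then
    [|M T k| + |T k T l| <= h / 6 + h / 3 < h]. *)
Lemma thick_along_radii eps i j : 0 < eps < 1 / 12 -> thick_along eps T i j ->
  intrinsic_radius (surface T) = extrinsic_radius (surface T).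
Proof.
move=> /andP[eps0 eps1] [long [k [l [kl sub]]]].
have ij := long.1; pose M := midpoint (T i) (T j).
pose h := enorm (T i - T j) / 2.
have h0 : 0 < h.
  rewrite divr_gt0// lt_neqAle enorm_ge0 andbT eq_sym; apply/eqP => /enorm_eq0 E.
  have [k' [l' u]] := exists_uniq4 ij.
  have [||/eqP + _ _ _] := @vert_aff_free R T _ _ _ _ u 1 (-1) 0 0.
  - by lra.
  - by rewrite !scale0r !addr0 scaleN1r scale1r.
  by rewrite oner_eq0.
have small : eps * extrinsic_diam (surface T) <= h / 6.
  have := ler_wpM2l (ltW eps0) (extrinsic_diam_le long).
  have := ler_wpM2r (ltW h0) (ltW eps1).
  by rewrite /h; lra.
have near n : n = k \/ n = l -> enorm (M - T n) <= h / 6.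
  move=> nkl; rewrite enormB; apply: (le_trans _ small); apply: sub.
  by apply/segmentE; case: nkl => ->; [exists 0|exists 1];
    rewrite ?subr0 ?subrr ?scale0r ?scale1r ?addr0 ?add0r.
have Mk := near k (or_introl erefl); have Ml := near l (or_intror erefl).
have kl' := enorm_dist (T k) M (T l).
rewrite (enormB (T k) M) in kl'.
have Mi : enorm (M - T i) = h := enorm_midpointl _ _.
have Mj : enorm (M - T j) = h := enorm_midpointr _ _.
(* The edge in the ball is opposite to the longest one: its ends are within [h / 6] of [M], while
   [T i] and [T j] are at distance [h]. *)
have neq m n : enorm (M - T m) = h -> enorm (M - T n) <= h / 6 -> m != n.
  by move=> Mm Mn; apply/eqP => mn; move: Mn; rewrite -mn Mm; lra.
have u : uniq [:: i; j; k; l].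
  by rewrite /= !inE !negb_or ij kl !neq.
by have [||| -> ->] := radii_thick u; rewrite -/h -/M; lra.
Qed.

End Radii.

(** * An explicit tetrahedron with equal radii *)

Section Example.
Variable R : realType.

Definition row3 (a b c : R) : 'rV[R]_3 := \row_j [:: a; b; c]`_j.

Lemma row3B a b c a' b' c' :
  row3 a b c - row3 a' b' c' = row3 (a - a') (b - b') (c - c').
Proof. by apply/rowP => -[[|[|[|]]] ?]//; rewrite !mxE. Qed.

Lemma enorm_row3_le a b c r : 0 <= r -> a ^+ 2 + b ^+ 2 + c ^+ 2 <= r ^+ 2 ->
  enorm (row3 a b c) <= r.
Proof.
move=> r0 abc; rewrite -ler_sqr ?nnegrE ?enorm_ge0// enorm_sqr /dot.
by rewrite !big_ord_recl big_ord0 !mxE/= addr0 addrA -!expr2.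
Qed.

(** An edge of length 8 centred at the origin, and an opposite edge of length 2 in an orthogonal
    direction, centred at height 1 on the third axis. *)
Definition slim_vert (i : 'I_4) : 'rV[R]_3 :=
  [:: row3 4 0 0; row3 (-4) 0 0; row3 0 1 1; row3 0 (-1) 1]`_i.

Lemma slim_vert_free :
  row_free (\matrix_(i < 3) (slim_vert (lift ord0 i) - slim_vert ord0)).
Proof.
(* The inverse of the edge matrix with rows [(-8, 0, 0)], [(-4, 1, 1)] and [(-4, -1, 1)]. *)
apply/row_freeP; exists (\matrix_(i < 3)
  [:: row3 (- 8^-1) 0 0; row3 0 2^-1 (- 2^-1); row3 (- 2^-1) 2^-1 2^-1]`_i).
apply/matrixP => -[[|[|[|]]] hi]// -[[|[|[|]]] hj]//;
  rewrite !mxE !big_ord_recl big_ord0; do 5 rewrite ?mxE /=; lra.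
Qed.

Lemma exists_tetrahedron_equal_radii : exists T : tetrahedron R,
  intrinsic_radius (surface T) / extrinsic_radius (surface T) = 1.
Proof.
pose T := Tetrahedron slim_vert_free; exists T.
pose i n (h : (n < 4)%N) := Ordinal h.
have M0 : midpoint (T (@i 0%N isT)) (T (@i 1%N isT)) = row3 0 0 0.
  by apply/rowP => -[[|[|[|]]] hj]//; rewrite !mxE /=; lra.
have h : enorm (T (@i 0%N isT) - T (@i 1%N isT)) / 2 = 4.
  rewrite -enorm_midpointl M0 row3B /enorm /dot.
  rewrite !big_ord_recl big_ord0 !mxE /=.
  have -> : (0 - 4) * (0 - 4) + ((0 - 0) * (0 - 0) + ((0 - 0) * (0 - 0) + 0))
    = 4 ^+ 2 :> R by lra.
  by rewrite sqrtr_sqr ger0_norm.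
have [|||-> ->] := @radii_thick R T (@i 0%N isT) (@i 1%N isT) (@i 2%N isT)
  (@i 3%N isT) isT; last by rewrite h divff.
- by rewrite h M0 row3B enorm_row3_le//; lra.
- by rewrite h M0 row3B enorm_row3_le//; lra.
- rewrite h M0 !row3B.
  (* The two lengths are the square root of 2 and 2, each at most 2. *)
  have -> : 4 = 2 + 2 :> R by lra.
  by rewrite lerD// enorm_row3_le//; lra.
Qed.

End Example.

Theorem proposition4 (R : realType) :
  [/\ forall T : tetrahedron R,
        1 <= intrinsic_radius (surface T) / extrinsic_radius (surface T) < 2,
      exists T : tetrahedron R,
        intrinsic_radius (surface T) / extrinsic_radius (surface T) = 1
    & exists eps0 : R, 0 < eps0 /\
        forall (eps : R) (T : tetrahedron R),
          0 < eps < eps0 -> normal_thick eps T ->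
          intrinsic_radius (surface T) = extrinsic_radius (surface T)].
Proof.
split=> [T||].
- have [r0 /andP[lo hi]] := intrinsic_radius_lt_double T.
  by rewrite ler_pdivlMr// mul1r lo ltr_pdivrMr.
- exact: exists_tetrahedron_equal_radii.
exists (1 / 12); split=> [|eps T epsE [i [j [_ [_ [thick _ _ _ _]]]]]]; first lra.
exact: thick_along_radii epsE thick.
Qed.
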